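(* Suppose that $A$, $B$ and $Z$ are totally ordered sets and that $f\colon A\times B\to Z$ is a proper bimonotone map. Then the bimonotone enumeration algorithm (described in the context) produces a stream enumerating all pairs $(a,b)\in A\times B$ (each exactly once) such that the values $f(a,b)$ appear in increasing (i.e. non-decreasing) order. In order to enumerate the first $n$ values, the algorithm builds up a priority queue of length at most $\sqrt{2n}+1$. If $f$ behaves polynomially, the algorithm takes time $O(n\log^2 n)$ and requires memory $O(\sqrt{n} \log n)$ to enumerate the first $n$ values (bit-complexity, with hidden constants possibly depending on $f$).
   Context: A map $f\colon A\times B\to Z$ is bimonotone if $a\le a'$ and $b\le b'$ imply $f(a,b)\le f(a',b')$. It is proper if for every $z \in \operatorname{Im}(f)$ only finitely many pairs $(a,b)\in A\times B$ satisfy $f(a,b)\le z$ (this implies that each of $A$, $B$ is finite or order-isomorphic to the natural numbers). All operations (comparison, successor, evaluation of $f$) are assumed computable. Bimonotone enumeration algorithm. For $a\in A$ let $\sigma a$ denote the successor of $a$ in $A$ (with $\sigma a=+\infty$ if $a$ is the greatest element), and similarly for $b\in B$; let $a_{\min},b_{\min}$ be the least elements. The algorithm maintains a doubly linked list $M$ of pairs in $A\times B$ and a priority queue $F$ containing the values $f(a,b)$ for $(a,b)\in M$, each stored with a pointer to its pair $(a,b)$ in $M$. By convention the predecessor of the first element of $M$ is $(-\infty,+\infty)$ and the successor of the last element of $M$ is $(+\infty,-\infty)$. (1) Initialize $M=\langle (a_{\min},b_{\min})\rangle$ and $F=\langle f(a_{\min},b_{\min})\rangle$. (2) While $F$ is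 non-empty: remove a minimal element $f(a,b)$ from $F$ and output $(a,b)$; let $(a^*,b_* )$ be the successor of $(a,b)$ in $M$; if $\sigma a<a^*$, insert $(\sigma a,b)$ into $M$ right after $(a,b)$ and insert $f(\sigma a,b)$ into $F$; let $(a_*,b^* )$ be the predecessor of $(a,b)$ in $M$; if $\sigma b<b^*$, insert $(a,\sigma b)$ into $M$ right after $(a,b)$ and insert $f(a,\sigma b)$ into $F$; remove $(a,b)$ from $M$. Cost model: $f$ behaves polynomially if the bit-complexity per element is $\Theta(\log n)$ when $n$ elements are enumerated, i.e. the (worst-case, and typical) cost in memory for storing an element $(f(a,b),a,b)$, and in time for calculating, copying and comparing such elements, is $\Theta(\log n)$ (factors of order $\log\log n$ or less are neglected). Each list operation costs time $O(\log n)$; each insertion into, or extraction of a minimum from, a priority queue of length $m$ takes $O(\log m)$ elementary steps on elements, i.e. time $O(\log n\,\log m)$. *)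

(* Defs.v *)
From mathcomp Require Import all_boot all_order all_algebra.
From mathcomp Require Import all_classical all_reals all_analysis.

Set Implicit Arguments.
Unset Strict Implicit.
Unset Printing Implicit Defensive.

Import Order.TTheory GRing.Theory Num.Theory.

Local Open Scope classical_set_scope.
Local Open Scope order_scope.
Local Open Scope nat_scope.

Section Maps.
Context {dA dB dZ : Order.disp_t}.
Context {A : orderType dA} {B : orderType dB} {Z : orderType dZ}.

Definition bimonotone (f : A * B -> Z) : Prop :=
  forall (a a' : A) (b b' : B),
    (a <= a')%O -> (b <= b')%O -> (f (a, b) <= f (a', b'))%O.

Definition proper_map (f : A * B -> Z) : Prop :=
  forall z : Z, range f z -> finite_set [set p : A * B | (f p <= z)%O].

End Maps.

Section Successor.
Context {d : Order.disp_t} {A : orderType d}.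

Definition least (m : A) : Prop := forall a : A, (m <= a)%O.

(* [None] stands for +oo, both here and in [lt_inf]. *)
Definition successor_fun (s : A -> option A) : Prop :=
  forall a : A,
    if s a is Some a'
    then (a < a')%O /\ (forall x : A, (a < x)%O -> (a' <= x)%O)
    else forall x : A, (x <= a)%O.

Definition lt_inf (x y : option A) : bool :=
  match x, y with
  | Some x', Some y' => (x' < y')%O
  | Some _, None => true
  | None, _ => false
  end.

End Successor.

(* The list is duplicate-free along every execution, so that a pair also
   serves as the pointer to its node. *)
Section LinkedList.
Context {E : eqType}.
Implicit Types (M : seq E) (e x : E).

Definition next_in M e : option E := onth M (index e M).+1.

Definition prev_in M e : option E :=
  if index e M is i.+1 then onth M i else None.

Definition insert_after M e x : seq E :=
  take (index e M).+1 M ++ x :: drop (index e M).+1 M.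

End LinkedList.

(* [Calc e] is one evaluation at the pair e of f or of one of the two successor
   functions; an element (f(a,b),a,b) is represented by (a,b). *)
Inductive elem_op (E : Type) : Type :=
  | Calc of E
  | Copy of E
  | Compare of E & E.

Definition elem_op_args {E : Type} (o : elem_op E) : seq E :=
  match o with
  | Calc e => [:: e]
  | Copy e => [:: e]
  | Compare e e' => [:: e; e']
  end.

Inductive list_op (E : Type) : Type :=
  | ListInit of E
  | ListNext of seq E & E
  | ListPrev of seq E & E
  | ListInsertAfter of seq E & E & E
  | ListRemove of seq E & E.

Inductive op (E : Type) : Type :=
  | OnElem of elem_op E
  | OnList of list_op E.

(* An implementation of priority queues.  Ties between equal keys are broken by
   the implementation, in an arbitrary way.  [pq_insert_steps e q] and
   [pq_extract_steps q] are the elementary steps executed by [pq_insert e q]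
   and [pq_extract q]. *)
Record pqueue (d : Order.disp_t) (Z : orderType d) (E : eqType)
    (key : E -> Z) := PQueue {
  pq_state : Type;
  pq_elems : pq_state -> seq E;
  pq_empty : pq_state;
  pq_insert : E -> pq_state -> pq_state;
  pq_extract : pq_state -> option (E * pq_state);
  pq_insert_steps : E -> pq_state -> seq (elem_op E);
  pq_extract_steps : pq_state -> seq (elem_op E);
  pq_emptyP : pq_elems pq_empty = [::];
  pq_insertP : forall e q,
    perm_eq (pq_elems (pq_insert e q)) (e :: pq_elems q);
  pq_extractP : forall q,
    if pq_extract q is Some (e, q')
    then perm_eq (pq_elems q) (e :: pq_elems q')
         /\ (forall e', e' \in pq_elems q -> (key e <= key e')%O)
    else pq_elems q = [::];
  pq_insert_stepsP : forall e q,
    {subset flatten (map elem_op_args (pq_insert_steps e q))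
     <= e :: pq_elems q};
  pq_extract_stepsP : forall q,
    {subset flatten (map elem_op_args (pq_extract_steps q)) <= pq_elems q}
}.

Definition pq_length {d : Order.disp_t} {Z : orderType d} {E : eqType}
    {key : E -> Z} {Q : pqueue key} (q : pq_state Q) : nat :=
  size (pq_elems q).

(* The summand 1 accounts for m <= 1, where ln m = 0. *)
Definition pq_logarithmic (R : realType) {d : Order.disp_t} {Z : orderType d}
    {E : eqType} {key : E -> Z} (Q : pqueue key) : Prop :=
  exists c : R, forall q : pq_state Q,
    ((size (pq_extract_steps q))%:R <= c * (1 + ln (pq_length q)%:R))%R /\
    (forall e : E,
      ((size (pq_insert_steps e q))%:R <= c * (1 + ln (pq_length q)%:R))%R).

Section Algorithm.
Context {dA dB dZ : Order.disp_t}.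
Context {A : orderType dA} {B : orderType dB} {Z : orderType dZ}.
Context {f : A * B -> Z}.
Variables (sA : A -> option A) (sB : B -> option B) (amin : A) (bmin : B).
Variable Q : pqueue f.

Local Notation E := (A * B)%type.

Record config := Config { cfg_list : seq E; cfg_queue : pq_state Q }.

Definition add_pair (c : config) (e x : E) : config :=
  Config (insert_after (cfg_list c) e x) (pq_insert x (cfg_queue c)).

Definition add_pair_ops (c : config) (e x : E) : seq (op E) :=
  [:: OnElem (Calc x); OnElem (Copy x);
      OnList (ListInsertAfter (cfg_list c) e x)]
  ++ map (@OnElem E) (pq_insert_steps x (cfg_queue c)).

(* [Some (sigma a, b)] if sigma a < a^*, where (a^*, b_* ) is the successor of
   e = (a, b) in the list, with a^* = +oo if e is the last pair. *)
Definition right_candidate (M : seq E) (e : E) : option E :=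
  if lt_inf (sA e.1) (omap fst (next_in M e))
  then omap (fun a' => (a', e.2)) (sA e.1) else None.

(* [Some (a, sigma b)] if sigma b < b^*, where (a_*, b^* ) is the predecessor of
   e = (a, b) in the list, with b^* = +oo if e is the first pair. *)
Definition up_candidate (M : seq E) (e : E) : option E :=
  if lt_inf (sB e.2) (omap snd (prev_in M e))
  then omap (fun b' => (e.1, b')) (sB e.2) else None.

Definition compare_ops (e : E) (nb : option E) : seq (op E) :=
  OnElem (Calc e)
  :: (if nb is Some e' then [:: OnElem (Compare e e')] else [::]).

Definition try_add (c : config) (e : E) (x : option E) : config * seq (op E) :=
  if x is Some x' then (add_pair c e x', add_pair_ops c e x') else (c, [::]).

(* [st_history] collects the configurations after each change of the queue,
   including those inside an iteration. *)
Record state := State {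
  st_cfg : config;
  st_out : seq E;
  st_trace : seq (op E);
  st_history : seq config
}.

Definition init : state :=
  let e := (amin, bmin) in
  let c := Config [:: e] (pq_insert e (pq_empty Q)) in
  State c [::]
    ([:: OnElem (Calc e); OnElem (Copy e); OnList (ListInit e)]
     ++ map (@OnElem E) (pq_insert_steps e (pq_empty Q)))
    [:: c].

Definition step (s : state) : state :=
  let c := st_cfg s in
  let M := cfg_list c in
  if pq_extract (cfg_queue c) is Some (e, q) then
    let c0 := Config M q in
    let: (c1, t1) := try_add c0 e (right_candidate M e) in
    let M1 := cfg_list c1 in
    let: (c2, t2) := try_add c1 e (up_candidate M1 e) in
    let M2 := cfg_list c2 in
    let c3 := Config (rem e M2) (cfg_queue c2) in
    State c3 (rcons (st_out s) e)
      (st_trace s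
       ++ map (@OnElem E) (pq_extract_steps (cfg_queue c))
       ++ [:: OnElem (Copy e)]
       ++ OnList (ListNext M e) :: compare_ops e (next_in M e) ++ t1
       ++ OnList (ListPrev M1 e) :: compare_ops e (prev_in M1 e) ++ t2
       ++ [:: OnList (ListRemove M2 e)])
      (st_history s ++ [:: c0; c1; c2; c3])
  else s.

Definition run (n : nat) : state := iter n step init.

(* The k-th output (counting from 0), if the algorithm does not stop before. *)
Definition output (k : nat) : option E := onth (st_out (run k.+1)) k.

Definition peak_queue_length (n : nat) : nat :=
  \max_(c <- st_history (run n)) pq_length (cfg_queue c).

Definition reaches (n : nat) : Prop := size (st_out (run n)) = n.

(* All the pairs inserted so far: those output and those still in the list. *)
Definition handled (n : nat) : seq E :=
  st_out (run n) ++ cfg_list (st_cfg (run n)).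

End Algorithm.

Section Asymptotics.
Context {R : realType}.

(* u = O(v) and u = Theta(v), for n tending to infinity inside D. *)
Definition bigO_on (D : nat -> Prop) (u v : nat -> R) : Prop :=
  exists (C : R) (N : nat),
    forall n : nat, N <= n -> D n -> (`|u n| <= C * `|v n|)%R.

Definition bigTheta_on (D : nat -> Prop) (u v : nat -> R) : Prop :=
  bigO_on D u v /\ bigO_on D v u.

Definition worst (s : seq nat) : R := (\max_(x <- s) x)%:R%R.

Definition mean (s : seq nat) : R := ((\sum_(x <- s) x)%:R / (size s)%:R)%R.

End Asymptotics.

(* All costs are numbers of bits, resp. of bit operations. *)
Record cost_model (E : Type) := CostModel {
  elem_memory : E -> nat;
  elem_time : elem_op E -> nat;
  list_time : list_op E -> nat
}.

Section Cost.
Context {dA dB dZ : Order.disp_t}.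
Context {A : orderType dA} {B : orderType dB} {Z : orderType dZ}.
Context {f : A * B -> Z}.
Variables (sA : A -> option A) (sB : B -> option B) (amin : A) (bmin : B).
Variable Q : pqueue f.
Variable cm : cost_model (A * B)%type.

Local Notation run := (run sA sB amin bmin Q).
Local Notation reaches := (reaches sA sB amin bmin Q).
Local Notation handled := (handled sA sB amin bmin Q).

Definition op_time (o : op (A * B)%type) : nat :=
  match o with
  | OnElem o' => elem_time cm o'
  | OnList o' => list_time cm o'
  end.

Definition total_time (n : nat) : nat :=
  \sum_(o <- st_trace (run n)) op_time o.

(* Number of bits of a possibly null pointer to a node of a list of length m. *)
Definition pointer_bits (m : nat) : nat := up_log 2 m.+1.

(* A list node holds pointers to its two neighbours, a queue entry a pointer to
   its list node. *)
Definition config_memory (c : config Q) : nat :=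
  let w := pointer_bits (size (cfg_list c)) in
  \sum_(e <- cfg_list c) (elem_memory cm e + 2 * w)
  + \sum_(e <- pq_elems (cfg_queue c)) (elem_memory cm e + w).

Definition peak_memory (n : nat) : nat :=
  \max_(c <- st_history (run n)) config_memory c.

(* Both the worst and the typical cost are Theta(log n).  "Typical" is the mean:
   given the worst-case bound, a mean of order log n says exactly that a positive
   proportion of the costs is at least of order log n. *)
Definition log_cost (R : realType) (costs : nat -> seq nat) : Prop :=
  bigTheta_on reaches (fun n => worst (costs n)) (fun n => ln n%:R : R)%R /\
  bigTheta_on reaches (fun n => mean (costs n)) (fun n => ln n%:R : R)%R.

Definition behaves_polynomially (R : realType) : Prop :=
  [/\ log_cost R (fun n => [seq elem_memory cm e | e <- handled n]),
      log_cost R (fun n => [seq elem_time cm (Calc e) | e <- handled n]),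
      log_cost R (fun n => [seq elem_time cm (Copy e) | e <- handled n]) &
      log_cost R (fun n => [seq elem_time cm (Compare e e')
                           | e <- handled n, e' <- handled n])].

Definition list_time_in (o : op (A * B)%type) : nat :=
  if o is OnList o' then list_time cm o' else 0.

Definition logarithmic_list_ops (R : realType) : Prop :=
  bigO_on reaches
    (fun n => (\max_(o <- st_trace (run n)) list_time_in o)%:R : R)%R
    (fun n => ln n%:R : R)%R.

End Cost.

(* Main.v *)
Require Import Defs.
From mathcomp Require Import all_boot all_order all_algebra.
From mathcomp Require Import all_classical all_reals all_analysis.
From mathcomp Require Import zify ring lra.

(* Order A x B componentwise. The list M is a staircase (first coordinates
   increase, second coordinates decrease) and consists of the minimal elements
   of the set of pairs that have not been output yet: every such pair lies
   above an element of M, and no pair that was output does. As f is bimonotone,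
   a minimum of f on M is then a minimum of f on all remaining pairs, and
   properness makes every pair appear after finitely many steps. If M consists
   of (a_1, b_1), ..., (a_m, b_m), the m(m-1)/2 pairs (a_i, b_j) with i < j lie
   above no element of M, so they have been output: m(m-1) <= 2n, which bounds
   the queue, and with it the steps per iteration and the memory. *)

Set Implicit Arguments.
Unset Strict Implicit.
Unset Printing Implicit Defensive.

Import Order.TTheory GRing.Theory Num.Theory.

(** * Staircases and the two candidates *)

Section LinkedListCat.
Context {T : eqType}.
Implicit Types (M : seq T) (e x : T).

Lemma next_in_cat M1 e M2 :
  e \notin M1 -> next_in (M1 ++ e :: M2) e = ohead M2.
Proof.
move=> eM1; rewrite /next_in index_cat (negbTE eM1) index_head addn0.
by rewrite onth_cat ltnNge leqnSn subSnn; case: M2.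
Qed.

Lemma prev_in_cat M1 e M2 :
  e \notin M1 -> prev_in (M1 ++ e :: M2) e = ohead (rev M1).
Proof.
move=> eM1; rewrite /prev_in index_cat (negbTE eM1) index_head addn0.
case/lastP: M1 eM1 => [//|M1 x] _; rewrite rev_rcons size_rcons.
by rewrite onth_cat size_rcons leqnn -cats1 onth_cat ltnn subnn.
Qed.

Lemma insert_after_cat M1 e M2 x :
  e \notin M1 -> insert_after (M1 ++ e :: M2) e x = M1 ++ e :: x :: M2.
Proof.
move=> eM1; rewrite /insert_after index_cat (negbTE eM1) index_head addn0.
by rewrite take_cat drop_cat ltnNge leqnSn subSnn /= take0 drop0 -catA.
Qed.

Lemma rem_cat_notin M1 e M2 : e \notin M1 -> rem e (M1 ++ e :: M2) = M1 ++ M2.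
Proof.
elim: M1 => [|x M1 IH] /=; first by rewrite eqxx.
by rewrite inE negb_or eq_sym => /andP[/negbTE -> /IH ->].
Qed.

End LinkedListCat.

Section Staircase.
Context {dA dB : Order.disp_t} {A : orderType dA} {B : orderType dB}.
Implicit Types (p q : A * B) (M : seq (A * B)).

Definition stair p q := (p.1 < q.1)%O && (q.2 < p.2)%O.

Definition le2 p q := (p.1 <= q.1)%O && (p.2 <= q.2)%O.

Lemma stair_irr p : stair p p = false.
Proof. by rewrite /stair ltxx. Qed.

Lemma le2_refl p : le2 p p.
Proof. by rewrite /le2 !lexx. Qed.

Lemma le2_trans : transitive le2.
Proof.
move=> q p r /andP[pq1 pq2] /andP[qr1 qr2].
by rewrite /le2 (le_trans pq1 qr1) (le_trans pq2 qr2).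
Qed.

Lemma stair_le2F p q : stair p q || stair q p -> le2 p q = false.
Proof.
by case/orP => /andP[h1 h2]; rewrite /le2 ?[(_.2 <= _.2)%O]leNgt ?h2 ?andbF //
  leNgt h1.
Qed.

Lemma stair_uniq M : pairwise stair M -> uniq M.
Proof. by apply: pairwise_uniq => p; rewrite stair_irr. Qed.

(** Elements at two different positions are ordered strictly and in opposite senses by the two
    coordinates, so they are incomparable for [le2]. *)
Lemma stair_antichain M p q :
  pairwise stair M -> p \in M -> q \in M -> le2 p q -> p = q.
Proof.
move=> + /[dup] pM /(nthP p) [i iM <-] /(nthP p) [j jM <-].
move=> /(pairwiseP p) st.
case: (ltngtP i j) => [ij|ji|-> //].
  by rewrite stair_le2F // st.
by rewrite stair_le2F // orbC st.
Qed.

Lemma stair_cat_notin M1 e M2 :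
  pairwise stair (M1 ++ e :: M2) -> (e \notin M1) && (e \notin M2).
Proof.
by move/stair_uniq; rewrite cat_uniq /= negb_or => /and4P[_ /andP[-> _] -> _].
Qed.

End Staircase.

Section Candidates.
Context {dA dB : Order.disp_t} {A : orderType dA} {B : orderType dB}.
Variables (sA : A -> option A) (sB : B -> option B).
Implicit Types (M : seq (A * B)) (e : A * B).

(** First coordinates increase along [M2], so the comparison with its head decides for all of [M2].
    If the candidate is rejected, this head is the witness [m] and will cover the pairs to the right
    of [e]. *)
Lemma right_candidateP M1 M2 e : e \notin M1 -> pairwise stair M2 ->
  match sA e.1, right_candidate sA (M1 ++ e :: M2) e with
  | Some a', Some r => r = (a', e.2) /\ {in M2, forall m, (a' < m.1)%O}
  | Some a', None => exists2 m, m \in M2 & (m.1 <= a')%O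
  | None, r => r = None
  end.
Proof.
move=> eM1; rewrite /right_candidate next_in_cat //.
case: (sA e.1) => [a'|] //=.
case: M2 => [|m M] //= /andP[mM _]; case: (ltP a' m.1) => /= am.
  split=> [//|m']; rewrite inE => /predU1P[->//|/(allP mM) /andP[mm' _]].
  exact: lt_trans mm'.
by exists m; rewrite ?inE ?eqxx.
Qed.

(** Mirror image: second coordinates decrease along [M1], so its last element, the predecessor of
    [e], has the smallest one. *)
Lemma up_candidateP M1 M2 e : e \notin M1 -> pairwise stair M1 ->
  match sB e.2, up_candidate sB (M1 ++ e :: M2) e with
  | Some b', Some u => u = (e.1, b') /\ {in M1, forall m, (b' < m.2)%O}
  | Some b', None => exists2 m, m \in M1 & (m.2 <= b')%O
  | None, u => u = None
  end.
Proof.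
move=> eM1; rewrite /up_candidate prev_in_cat //.
case: (sB e.2) => [b'|] //=.
case/lastP: M1 eM1 => [|M m] //= eM1.
rewrite rev_rcons pairwise_rcons /= => /andP[mM _].
case: (ltP b' m.2) => /= bm.
  split=> [//|m']; rewrite mem_rcons inE.
  case/predU1P => [->//|/(allP mM) /andP[_ mm']].
  exact: lt_trans mm'.
by exists m; rewrite ?mem_rcons ?inE ?eqxx.
Qed.

End Candidates.

(** * Replacing an element of the staircase by its candidates *)

Section Replacement.
Context {dA dB : Order.disp_t} {A : orderType dA} {B : orderType dB}.
Variables (sA : A -> option A) (sB : B -> option B).
Hypotheses (sA_succ : successor_fun sA) (sB_succ : successor_fun sB).
(* The algorithm looks for the second candidate after inserting the first one,
   so the part M3 of the list behind e may differ from M2. *)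
Variables (M1 M2 M3 : seq (A * B)) (e : A * B).
Hypothesis stM : pairwise stair (M1 ++ e :: M2).

Local Notation r := (seq_of_opt (right_candidate sA (M1 ++ e :: M2) e)).
Local Notation u := (seq_of_opt (up_candidate sB (M1 ++ e :: M3) e)).

Let eM1 : e \notin M1. Proof. by case/andP: (stair_cat_notin stM). Qed.

Let stM1 : pairwise stair M1.
Proof. by move: stM; rewrite pairwise_cat => /and3P[]. Qed.

Let stM2 : pairwise stair M2.
Proof. by move: stM; rewrite pairwise_cat => /and3P[_ _ /andP[]]. Qed.

Lemma mem_right_candidate p : p \in r ->
  [/\ (e.1 < p.1)%O, p.2 = e.2 & {in M2, forall m, (p.1 < m.1)%O}].
Proof.
have := right_candidateP sA eM1 stM2; have := sA_succ e.1.
case: (sA e.1) => [a' [ea _]|_ ->] //; case: right_candidate => [x [-> h]|] //=.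
by rewrite inE => /eqP ->.
Qed.

Lemma mem_up_candidate p : p \in u ->
  [/\ (e.2 < p.2)%O, p.1 = e.1 & {in M1, forall m, (p.2 < m.2)%O}].
Proof.
have := up_candidateP sB M3 eM1 stM1; have := sB_succ e.2.
case: (sB e.2) => [b' [eb _]|_ ->] //; case: up_candidate => [x [-> h]|] //=.
by rewrite inE => /eqP ->.
Qed.

Lemma stair_before m : m \in M1 -> stair m e.
Proof.
by move: stM; rewrite pairwise_cat allrel_consr => /andP[/andP[/allP h _] _] /h.
Qed.

Lemma stair_after m : m \in M2 -> stair e m.
Proof.
by move: stM; rewrite pairwise_cat /= => /and4P[_ _ /allP h _] /h.
Qed.

Lemma seq_of_opt_pairwise (T : Type) (R : rel T) (x : option T) :
  pairwise R (seq_of_opt x).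
Proof. by case: x. Qed.

(** For [e] = (a, b) the candidates are (a, sigma b) and (sigma a, b), in this order. Each keeps one
    coordinate of [e], which settles one comparison with the neighbours; the other is the test made
    by the algorithm or follows from the position of [e]. *)
Lemma stair_replace : pairwise stair (M1 ++ u ++ r ++ M2).
Proof.
rewrite !pairwise_cat !seq_of_opt_pairwise stM1 stM2 !allrel_catr !andbT /=.
have := stM; rewrite pairwise_cat allrel_consr => /andP[/andP[_ ->] _].
rewrite andbT; apply/andP; split.
  apply/andP; split; apply/allrelP => m p mM.
    move/mem_up_candidate => [_ pe /(_ _ mM) h].
    by rewrite /stair pe h andbT; case/andP: (stair_before mM).
  move/mem_right_candidate => [ep pe _].
  have /andP[me em] := stair_before mM.
  by rewrite /stair pe em (lt_trans me ep).
apply/andP; split.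
  apply/andP; split; apply/allrelP => p m /mem_up_candidate [ep pe _].
    by move/mem_right_candidate => [em me _]; rewrite /stair pe em me ep.
  move/stair_after => /andP[em me].
  by rewrite /stair pe em (lt_trans me ep).
apply/allrelP => p m /mem_right_candidate [ep pe h] mM.
by rewrite /stair pe h //; case/andP: (stair_after mM).
Qed.

(** If [p] exceeds [e] in the first coordinate, it lies above (sigma a, b) or, when this candidate
    was rejected, above an element of [M2] with first coordinate at most sigma a, whose second
    coordinate is below b. Otherwise [p] exceeds [e] in the second coordinate only, and the mirrored
    argument uses [u] and [M1]. *)
Lemma le2_replace p : le2 e p -> p != e ->
  exists2 m, m \in u ++ r ++ M1 ++ M2 & le2 m p.
Proof.
case: p => x y /andP[/= ex ey] pe.
have [ex'|] := ltP e.1 x.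
  have := right_candidateP sA eM1 stM2; have := sA_succ e.1.
  case: (sA e.1) => [a' [_ /(_ _ ex') ax]|/(_ x)]; last by rewrite leNgt ex'.
  case: right_candidate => [_ [-> _]|[m mM ma]].
    exists (a', e.2); first by rewrite !mem_cat inE eqxx !orbT.
    by rewrite /le2 /= ax.
  exists m; first by rewrite !mem_cat mM !orbT.
  have /andP[_ me] := stair_after mM.
  by rewrite /le2 /= (le_trans ma ax) (le_trans (ltW me)).
move=> xe; have {ex xe}xe : x = e.1 by apply/eqP; rewrite eq_le ex xe.
have ey' : (e.2 < y)%O.
  rewrite lt_neqAle ey andbT; apply: contra_neq pe => <-.
  by rewrite xe; case: e.
have := up_candidateP sB M3 eM1 stM1; have := sB_succ e.2.
case: (sB e.2) => [b' [_ /(_ _ ey') bx]|/(_ y)]; last by rewrite leNgt ey'.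
case: up_candidate => [_ [-> _]|[m mM mb]].
  exists (e.1, b'); first by rewrite !mem_cat inE eqxx.
  by rewrite /le2 /= xe lexx.
exists m; first by rewrite !mem_cat mM !orbT.
have /andP[me _] := stair_before mM.
by rewrite /le2 /= xe (ltW me) (le_trans mb bx).
Qed.

Lemma mem_candidate p : p \in u ++ r -> le2 e p && (p != e).
Proof.
rewrite mem_cat /le2 => /orP[/mem_up_candidate|/mem_right_candidate] [ep pe _].
  by rewrite pe lexx ltW //=; apply: contraTneq ep => ->; rewrite ltxx.
by rewrite pe lexx ltW //=; apply: contraTneq ep => ->; rewrite ltxx.
Qed.

End Replacement.

(** * Counting the pairs cut off by a staircase *)

Section Corners.
Context {dA dB : Order.disp_t} {A : orderType dA} {B : orderType dB}.
Implicit Types (p m : A * B) (M : seq (A * B)).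

(* All pairs (a_i, b_j) with i < j, for M = (a_1, b_1), ..., (a_m, b_m). *)
Fixpoint corners M : seq (A * B) :=
  if M is m :: M' then [seq (m.1, m'.2) | m' <- M'] ++ corners M' else [::].

Lemma mem_corners M p : p \in corners M ->
  (p.1 \in map fst M) && (p.2 \in map snd M).
Proof.
elim: M => //= m M IH; rewrite mem_cat !inE => /orP[/mapP[m' m'M ->] /=|/IH].
  by rewrite eqxx (map_f snd m'M) orbT.
by case/andP => -> ->; rewrite !orbT.
Qed.

(** Let the corner be (a_i, b_j) with i < j. An element at a position k <= i has b_k > b_j, and one
    at a position k > i has a_k > a_i. *)
Lemma corners_not_above M m p :
  pairwise stair M -> m \in M -> p \in corners M -> ~~ le2 m p.
Proof.
elim: M => //= m0 M IH /andP[/allP m0M stM].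
rewrite inE mem_cat => /predU1P[->|mM] /orP[/mapP[m' m'M ->]|pM].
- by have /andP[_ lt] := m0M _ m'M; rewrite /le2 negb_and -!ltNge lt orbT.
- have /andP[_ /mapP[m' m'M eq2]] := mem_corners pM.
  by have /andP[_ lt] := m0M _ m'M; rewrite /le2 eq2 negb_and -!ltNge lt orbT.
- by have /andP[lt _] := m0M _ mM; rewrite /le2 negb_and -!ltNge lt.
- exact: IH.
Qed.

(** Corners with the same i differ in the second coordinate, those with different i in the first. *)
Lemma corners_uniq M : pairwise stair M -> uniq (corners M).
Proof.
elim: M => //= m M IH /andP[/allP mM stM].
rewrite cat_uniq IH // andbT; apply/andP; split.
  rewrite map_inj_in_uniq ?stair_uniq // => m1 m2 m1M m2M [eq2].
  have [/nthP -/(_ m) [i iM e1] /nthP -/(_ m) [j jM e2]] := (m1M, m2M).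
  move: stM => /(pairwiseP m) st; rewrite -e1 -e2 in eq2 *.
  case: (ltngtP i j) => [ij|ji|-> //].
    by have /andP[_] := st _ _ iM jM ij; rewrite eq2 ltxx.
  by have /andP[_] := st _ _ jM iM ji; rewrite eq2 ltxx.
apply/hasPn => p /mem_corners /andP[/mapP[m' m'M eq1] _].
apply/negP => /mapP[m'' _ eqp]; have /andP[+ _] := mM _ m'M.
by rewrite -eq1 eqp ltxx.
Qed.

Lemma size_corners M : 2 * size (corners M) = size M * (size M).-1.
Proof.
elim: M => //= m M IH; rewrite size_cat size_map mulnDr IH.
by case: (size M) => // k; nia.
Qed.

End Corners.

(** * One iteration *)

Section Iteration.
Context {dA dB dZ : Order.disp_t}.
Context {A : orderType dA} {B : orderType dB} {Z : orderType dZ}.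
Context {f : A * B -> Z}.
Variables (sA : A -> option A) (sB : B -> option B) (Q : pqueue f).
Hypotheses (f_bimonotone : bimonotone f).
Hypotheses (sA_succ : successor_fun sA) (sB_succ : successor_fun sB).

Local Notation E := (A * B)%type.
Implicit Types (s : state Q) (p e m d : E) (M : seq E).

Lemma le2_key p p' : le2 p p' -> (f p <= f p')%O.
Proof. by case: p p' => [a b] [a' b'] /andP[]; exact: f_bimonotone. Qed.

(** Together, [inv_stair], [inv_fresh] and [inv_cover] make the list the set of minimal elements
    among the pairs not yet output. [inv_le] is what keeps the outputs sorted when one more is
    appended. *)
Record loop_invariant (s : state Q) : Prop := LoopInvariant {
  inv_queue :
    perm_eq (pq_elems (cfg_queue (st_cfg s))) (cfg_list (st_cfg s));
  inv_stair : pairwise stair (cfg_list (st_cfg s));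
  inv_fresh :
    forall m d, m \in cfg_list (st_cfg s) -> d \in st_out s -> ~~ le2 m d;
  inv_cover : forall p, p \notin st_out s ->
    exists2 m, m \in cfg_list (st_cfg s) & le2 m p;
  inv_uniq : uniq (st_out s);
  inv_sorted : pairwise (fun p p' => f p <= f p')%O (st_out s);
  inv_le : forall d m,
    d \in st_out s -> m \in cfg_list (st_cfg s) -> (f d <= f m)%O
}.

Definition insert_opt (x : option E) (q : pq_state Q) : pq_state Q :=
  if x is Some x' then pq_insert x' q else q.

Lemma insert_optP x q :
  perm_eq (pq_elems (insert_opt x q)) (seq_of_opt x ++ pq_elems q).
Proof. by case: x => [x|] //=; exact: pq_insertP. Qed.

Definition add_opt_ops (c : config Q) e (x : option E) : seq (op E) :=
  if x is Some x' then add_pair_ops c e x' else [::].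

Definition iteration_trace s e (r u : option E) M1 M2 c0 c1 : seq (op E) :=
  map (@OnElem E) (pq_extract_steps (cfg_queue (st_cfg s)))
  ++ [:: OnElem (Copy e); OnList (ListNext (M1 ++ e :: M2) e)]
  ++ compare_ops e (ohead M2)
  ++ add_opt_ops c0 e r
  ++ [:: OnList (ListPrev (M1 ++ e :: seq_of_opt r ++ M2) e)]
  ++ compare_ops e (ohead (rev M1))
  ++ add_opt_ops c1 e u
  ++ [:: OnList (ListRemove (M1 ++ e :: seq_of_opt u ++ seq_of_opt r ++ M2) e)].

(** Splitting the list at [e] turns pointer operations into concatenations. Both insertions take
    place right behind [e], so [u], inserted second, precedes [r], and the first insertion leaves
    the predecessor of [e] unchanged. *)
Lemma stepE s e q M1 M2 :
  pq_extract (cfg_queue (st_cfg s)) = Some (e, q) ->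
  cfg_list (st_cfg s) = M1 ++ e :: M2 -> e \notin M1 ->
  let r := right_candidate sA (M1 ++ e :: M2) e in
  let M' := M1 ++ e :: seq_of_opt r ++ M2 in
  let u := up_candidate sB M' e in
  let c0 := Config (M1 ++ e :: M2) q in
  let c1 := Config M' (insert_opt r q) in
  let q2 := insert_opt u (insert_opt r q) in
  let c2 := Config (M1 ++ e :: seq_of_opt u ++ seq_of_opt r ++ M2) q2 in
  let c3 := Config (M1 ++ seq_of_opt u ++ seq_of_opt r ++ M2) q2 in
  step sA sB s =
    State c3 (rcons (st_out s) e)
      (st_trace s ++ iteration_trace s e r u M1 M2 c0 c1)
      (st_history s ++ [:: c0; c1; c2; c3]).
Proof.
move=> qe Me eM1; rewrite /step qe Me /=.
case: (right_candidate _ _ _) => [r|] /=;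
  rewrite /Defs.add_pair /= ?insert_after_cat //;
  case: (up_candidate _ _ _) => [u|] /=;
  rewrite /Defs.add_pair /= ?insert_after_cat // ?next_in_cat ?prev_in_cat //
    ?rem_cat_notin // /iteration_trace /=  -?catA ?cats0 //=.
Qed.

Lemma extract_split s e q : loop_invariant s ->
  pq_extract (cfg_queue (st_cfg s)) = Some (e, q) ->
  exists M1 M2, [/\ cfg_list (st_cfg s) = M1 ++ e :: M2,
    perm_eq (pq_elems q) (M1 ++ M2)
    & forall m, m \in cfg_list (st_cfg s) -> (f e <= f m)%O].
Proof.
move=> /inv_queue qM qe; have := pq_extractP (cfg_queue (st_cfg s)).
rewrite qe => -[qeq qmin].
have eM : e \in cfg_list (st_cfg s).
  by rewrite -(perm_mem qM) (perm_mem qeq) mem_head.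
have hmin m : m \in cfg_list (st_cfg s) -> (f e <= f m)%O.
  by rewrite -(perm_mem qM); exact: qmin.
case/splitPr: eM qM hmin => M1 M2 qM hmin; exists M1, M2; split=> //.
move: qM; rewrite perm_sym (perm_catCA M1 [:: e] M2) perm_sym (permPl qeq).
by rewrite perm_cons.
Qed.

Lemma invariant_step s : loop_invariant s -> loop_invariant (step sA sB s).
Proof.
move=> inv.
case qe: (pq_extract (cfg_queue (st_cfg s))) => [[e q]|]; last first.
  by rewrite /step qe.
have [M1 [M2 [Me qM emin]]] := extract_split inv qe.
have stM := inv_stair inv; rewrite Me in stM.
have /andP[eM1 eM2] := stair_cat_notin stM.
rewrite (stepE qe Me eM1) /=.
set r := right_candidate _ _ _; set u := up_candidate _ _ _.
have memC m : m \in seq_of_opt u ++ seq_of_opt r -> le2 e m && (m != e).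
  exact: (mem_candidate sA_succ sB_succ stM).
(* Each element of the new list is an old one other than [e], or a candidate strictly above [e]. *)
have memM m : m \in M1 ++ seq_of_opt u ++ seq_of_opt r ++ M2 ->
    m \in cfg_list (st_cfg s) /\ m != e \/ le2 e m && (m != e).
  rewrite Me !mem_cat inE => /or4P[h|h|h|h].
  - by left; rewrite h; split=> //; apply: contraNneq eM1 => <-.
  - by right; apply: memC; rewrite mem_cat h.
  - by right; apply: memC; rewrite mem_cat h orbT.
  - by left; rewrite h !orbT; split=> //; apply: contraNneq eM2 => <-.
have eM : e \in cfg_list (st_cfg s) by rewrite Me mem_cat mem_head orbT.
split=> /=.
- rewrite (permPl (insert_optP _ _)) perm_sym perm_catCA perm_cat2l.
  by rewrite perm_catCA perm_sym (permPl (insert_optP _ _)) perm_cat2l.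
- exact: (stair_replace sA_succ sB_succ).
(* An old element is not below [e] by the antichain property, nor a candidate by antisymmetry. An
   earlier output above a candidate would also be above [e]. *)
- move=> m d /memM mM; rewrite mem_rcons inE.
  case: mM => [[mM me]|/andP[em me]] /predU1P[->|dD].
  + apply: contraNN me => /(stair_antichain (inv_stair inv) mM eM) -> //.
  + exact: (inv_fresh inv).
  + apply: contraNN me; move: em; rewrite /le2 => /andP[h1 h2] /andP[h3 h4].
    by rewrite -pair_eqE /pair_eq /= !eq_le h1 h2 h3 h4.
  + by apply: contraNN (inv_fresh inv eM dD); exact: le2_trans.
- move=> p; rewrite mem_rcons inE negb_or => /andP[pe /(inv_cover inv) [m]].
  rewrite Me mem_cat inE => mM mp.
  have [h|me] := boolP (m \in M1 ++ M2).
    by exists m => //; move: h; rewrite !mem_cat => /orP[->|->]; rewrite ?orbT.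
  move: mM me mp; rewrite mem_cat negb_or.
  case/or3P => [-> //|/eqP->|->]; rewrite ?andbF // => _ mp.
  (* Here [m] was [e], the only element that disappears. The list behind [e] after the first
     insertion plays the role of [M3]. *)
  have [m' m'M m'p] := le2_replace sA_succ sB_succ
    (seq_of_opt r ++ M2) stM mp pe.
  exists m' => //; move: m'M; rewrite !mem_cat.
  by case/or4P => ->; rewrite ?orbT.
- rewrite rcons_uniq (inv_uniq inv) andbT.
  by apply/negP => eD; have := inv_fresh inv eM eD; rewrite le2_refl.
- rewrite pairwise_rcons (inv_sorted inv) andbT.
  by apply/allP => d dD; exact: (inv_le inv).
(* Old elements satisfy this because [e] was a minimum of the queue, candidates because [f] is
   bimonotone. *)
- move=> d m dD /memM mM; have em : (f e <= f m)%O.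
    by case: mM => [[/emin//]|/andP[/le2_key]].
  move: dD; rewrite mem_rcons inE => /predU1P[->//|dD].
  exact: le_trans (inv_le inv dD eM) em.
Qed.

(** A corner that had not been output would lie above some element of the list by [inv_cover]. So
    the corners are distinct outputs. *)
Lemma invariant_size s : loop_invariant s ->
  size (cfg_list (st_cfg s)) * (size (cfg_list (st_cfg s))).-1
    <= 2 * size (st_out s).
Proof.
move=> inv; have stM := inv_stair inv.
rewrite -size_corners leq_mul2l /=.
apply: uniq_leq_size (corners_uniq stM) _ => p pM; apply: contraT.
move=> /(inv_cover inv)[m mM]; apply/contraTT => _.
exact: corners_not_above pM.
Qed.

End Iteration.

(** * Numerical bounds *)

Section BigAll.
Context {T : Type}.
Implicit Types (s : seq T) (F : T -> nat).

Lemma all_bigmax (P : pred nat) F s :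
  P 0 -> all (fun x => P (F x)) s -> P (\max_(x <- s) F x).
Proof.
move=> P0; elim: s => [|x s IH] /=; first by rewrite big_nil.
by move=> /andP[Px /IH Ps]; rewrite big_cons /maxn; case: ifP.
Qed.

Lemma all_leq_bigmax F s : all (fun x => F x <= \max_(y <- s) F y) s.
Proof.
elim: s => //= x s IH; rewrite big_cons leq_maxl /=.
by apply: sub_all IH => y /leq_trans; apply; exact: leq_maxr.
Qed.

Lemma all_leq_sum F s b :
  all (fun x => F x <= b) s -> \sum_(x <- s) F x <= size s * b.
Proof.
elim: s => [|x s IH] /=; first by rewrite big_nil.
by move=> /andP[xb /IH sb]; rewrite big_cons mulSn leq_add.
Qed.

End BigAll.

Section RealBounds.
Context {R : realType}.

(** For m > 0, (m - 1)^2 <= m (m - 1) <= 2 n. *)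
Lemma triangular_sqrt (m n : nat) :
  m * m.-1 <= 2 * n -> (m%:R <= Num.sqrt (2 * n%:R) + 1 :> R)%R.
Proof.
case: m => [|k] /= h; first by rewrite addr_ge0 ?sqrtr_ge0.
have kE : (k%:R = Num.sqrt (k%:R ^+ 2) :> R)%R by rewrite sqrtr_sqr ger0_norm.
rewrite -natr1 lerD2r kE.
by rewrite ler_sqrt ?mulr_ge0 // -natrX -natrM ler_nat; nia.
Qed.

Lemma leq_truncn (m : nat) (x : R) : (m%:R <= x)%R -> m <= Num.truncn x.
Proof. by move=> mx; rewrite truncn_ge_nat // (le_trans _ mx). Qed.

(** Turns an asymptotic bound on the worst cost into a natural number bounding each single cost. The
    constant of [bigO_on] may have any sign, hence the absolute value. *)
Lemma worst_leq (s : seq nat) (C L : R) (x : nat) :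
  (`|worst s| <= C * `|L|)%R -> (x \in s) -> x <= Num.truncn (`|C| * `|L|)%R.
Proof.
move=> sC xs; apply: leq_truncn; apply: (@le_trans _ _ (C * `|L|)%R).
  apply: le_trans sC; rewrite /worst ger0_norm // ler_nat.
  exact: leq_bigmax_seq.
by rewrite ler_wpM2r // ler_norm.
Qed.

Lemma ln_nat_ge0 (n : nat) : (0 <= ln (n%:R : R))%R.
Proof. by case: n => [|n]; [rewrite ln0 | rewrite ln_ge0 // ler1n]. Qed.

Lemma ler_ln_nat (m n : nat) : m <= n -> (ln (m%:R : R) <= ln n%:R)%R.
Proof.
case: m => [_|m mn]; first by rewrite (@ln0 R 0%R) // ln_nat_ge0.
by rewrite ler_ln ?posrE ?ltr0n ?ler_nat // (leq_trans _ mn).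
Qed.

(** Beyond this threshold, additive constants can be absorbed into multiples of ln n. *)
Lemma ln_nat_ge1 (n : nat) :
  Num.truncn (expR 1 : R) < n -> (1 <= ln (n%:R : R))%R.
Proof.
move=> en.
rewrite -[leLHS]expRK ler_ln ?posrE ?expR_gt0 ?ltr0n ?(leq_trans _ en) //.
have /andP[_ /ltW h] := truncn_itv (expR_ge0 (1 : R)).
by apply: le_trans h _; rewrite ler_nat.
Qed.

(** For k = [up_log 2 m], 2^(k - 1) < m. *)
Lemma up_log_le_ln (m : nat) : 1 < m ->
  ((up_log 2 m)%:R <= 1 + ln m%:R / ln 2 :> R)%R.
Proof.
move=> m1; have ln2 : (0 < ln 2 :> R)%R by rewrite ln_gt0 // ltr1n.
have k0 : 0 < up_log 2 m by rewrite up_log_gt0.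
rewrite -(prednK k0) -natr1 addrC lerD2l ler_pdivlMr //.
have := ler_ln_nat (ltnW (up_log_gtn (isT : 1 < 2) m1)).
by rewrite natrX lnXn // mulr_natl.
Qed.

End RealBounds.

(** * Executions and their cost *)

Definition op_args {E : Type} (o : op E) : seq E :=
  if o is OnElem o' then elem_op_args o' else [::].

Section Run.
Context {dA dB dZ : Order.disp_t}.
Context {A : orderType dA} {B : orderType dB} {Z : orderType dZ}.
Context {f : A * B -> Z}.
Variables (sA : A -> option A) (sB : B -> option B) (amin : A) (bmin : B).
Variable (Q : pqueue f).
Hypotheses (f_bimonotone : bimonotone f).
Hypotheses (sA_succ : successor_fun sA) (sB_succ : successor_fun sB).
Hypotheses (amin_least : least amin) (bmin_least : least bmin).

Local Notation E := (A * B)%type.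
Local Notation run := (run sA sB amin bmin Q).
Local Notation handled := (handled sA sB amin bmin Q).
Local Notation step := (step sA sB (Q := Q)).

Lemma invariant_run n : loop_invariant (run n).
Proof.
elim: n => [|n IH]; last by rewrite /run iterS; exact: invariant_step.
split=> //=.
- by rewrite (permPl (pq_insertP _ _)) pq_emptyP.
- by move=> [a b] _; exists (amin, bmin); rewrite ?mem_head // /le2 /=
    amin_least bmin_least.
Qed.

(** * Number, completeness and order of the outputs *)

Lemma runS n : run n.+1 = step (run n).
Proof. by []. Qed.

Lemma step_halt s : pq_extract (cfg_queue (st_cfg s)) = None -> step s = s.
Proof. by rewrite /step => ->. Qed.

Lemma step_out s e q :
  loop_invariant s -> pq_extract (cfg_queue (st_cfg s)) = Some (e, q) ->
  st_out (step s) = rcons (st_out s) e.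
Proof.
move=> inv qe; have [M1 [M2 [Me _ _]]] := extract_split inv qe.
have := inv_stair inv; rewrite Me => /stair_cat_notin /andP[eM1 _].
by rewrite (stepE sA sB qe Me eM1).
Qed.

Lemma size_out n : size (st_out (run n)) <= n.
Proof.
elim: n => // n IH; rewrite runS.
case qe: (pq_extract (cfg_queue (st_cfg (run n)))) => [[e q]|].
  by rewrite (step_out (invariant_run n) qe) size_rcons.
by rewrite step_halt // leqW.
Qed.

(** A halted state is a fixed point of [step], so a queue that is still non-empty shows that no
    iteration was idle. *)
Lemma size_out_eq n :
  pq_extract (cfg_queue (st_cfg (run n))) -> size (st_out (run n)) = n.
Proof.
elim: n => // n IH; rewrite runS.
case qe: (pq_extract (cfg_queue (st_cfg (run n)))) => [[e q]|] h.
  by rewrite (step_out (invariant_run n) qe) size_rcons IH ?qe.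
by move: h; rewrite step_halt // qe.
Qed.

Lemma out_take k n : k <= n -> st_out (run k) = take k (st_out (run n)).
Proof.
elim: n => [|n IH]; first by rewrite leqn0 => /eqP ->.
rewrite leq_eqVlt ltnS => /predU1P[->|kn].
  by rewrite take_oversize ?size_out.
rewrite runS; case qe: (pq_extract (cfg_queue (st_cfg (run n)))) => [[e q]|].
  rewrite (step_out (invariant_run n) qe) -cats1 takel_cat ?IH //.
  by rewrite (size_out_eq (n := n)) ?qe.
by rewrite step_halt // IH.
Qed.

Lemma outputE k n :
  k < n -> output sA sB amin bmin Q k = onth (st_out (run n)) k.
Proof.
move=> kn; rewrite /output (out_take kn).
by rewrite -[in RHS](cat_take_drop k.+1 (st_out _)) onth_cat size_take_min;
  (* If there are at most [k] outputs, both sides are [None]. *)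
  case: ltnP => // h; rewrite !onth_default ?size_take_min //
  ?size_drop; move: h; rewrite geq_min ltnn /= => h; lia.
Qed.

Lemma handledS n : {subset handled n <= handled n.+1}.
Proof.
have inv := invariant_run n; move=> p; rewrite /Defs.handled runS.
case qe: (pq_extract (cfg_queue (st_cfg (run n)))) => [[e q]|]; last first.
  by rewrite step_halt.
have [M1 [M2 [Me _ _]]] := extract_split inv qe.
have := inv_stair inv; rewrite Me => /stair_cat_notin /andP[eM1 _].
rewrite (stepE sA sB qe Me eM1) /= !(mem_cat, inE, mem_rcons).
by case/or4P => ->; rewrite ?orbT.
Qed.

(** If [p] were never output, the list would always contain some [m] below [p], so the queue would
    never be empty and each extracted [e] would satisfy f e <= f m <= f p. All outputs would lie in
    the finite set [s], contradicting their distinctness after [(size s).+1] iterations. *)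
Lemma out_reached : proper_map f -> forall p, exists n, p \in st_out (run n).
Proof.
move=> f_proper p; apply: contrapT => /forallNP pout.
have /finite_seqP[s sE] := f_proper (f p) (ex_intro2 _ _ p I erefl).
have ins q : (q \in s) = (f q <= f p)%O.
  by apply/idP/idP => [|]; have := congr1 (fun X => X q) sE; rewrite /= => ->.
have hd n : exists e q, pq_extract (cfg_queue (st_cfg (run n))) = Some (e, q)
    /\ e \in s.
  have inv := invariant_run n.
  have [m mM mp] := inv_cover inv (introN idP (pout n)).
  case qe: (pq_extract (cfg_queue (st_cfg (run n)))) => [[e q]|].
    exists e, q; split=> //; rewrite ins.
    have [M1 [M2 [_ _ /(_ m mM) em]]] := extract_split inv qe.
    exact: le_trans em (le2_key f_bimonotone mp).
  have := pq_extractP (cfg_queue (st_cfg (run n))); rewrite qe => q0.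
  by have := perm_mem (inv_queue inv) m; rewrite q0 mM.
have sub n : {subset st_out (run n) <= s}.
  elim: n => // n IH; have [e [q [qe es]]] := hd n.
  rewrite runS (step_out (invariant_run n) qe) => q'.
  by rewrite mem_rcons inE => /predU1P[->|/IH].
have := uniq_leq_size (inv_uniq (invariant_run (size s).+1)) (sub _).
have [e [q [qe _]]] := hd (size s).+1.
by rewrite size_out_eq ?qe ?ltnn.
Qed.

Lemma output_exists_unique : proper_map f ->
  forall p, exists! k, output sA sB amin bmin Q k = Some p.
Proof.
move=> f_proper p; have [n] := out_reached f_proper p.
case/onthP => k kp.
have kn : k < n.
  by apply: leq_trans (size_out n); rewrite -onthTE kp.
exists k; split=> [|j jp]; first by rewrite (outputE kn).
(* Both indices are compared within one run long enough to contain them, whose outputs are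
   distinct. *)
have jn : j < maxn n j.+1 by rewrite leq_max leqnn orbT.
have kn' : k < maxn n j.+1 by rewrite leq_max kn.
have kp' : onth (st_out (run (maxn n j.+1))) k = Some p.
  by rewrite -(outputE kn') (outputE kn).
apply: (onth_inj _ _ _ (inv_uniq (invariant_run (maxn n j.+1)))).
  by rewrite gtn_min -onthTE -onthTE kp' ?orbT.
by rewrite kp' -(outputE jn).
Qed.

Lemma output_monotone i j p q : i <= j ->
  output sA sB amin bmin Q i = Some p -> output sA sB amin bmin Q j = Some q ->
  (f p <= f q)%O.
Proof.
rewrite leq_eqVlt => /predU1P[->|ij]; first by move=> -> [->].
rewrite (outputE (ltnSn j)) (outputE (ltnW ij : i < j.+1)) => ip jq.
have /(pairwiseP p) st := inv_sorted (invariant_run j.+1).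
rewrite -(onth_nth p _ _ _ ip) -(onth_nth p _ _ _ jq); apply: st => //.
  by rewrite inE /= -onthTE ip.
by rewrite inE /= -onthTE jq.
Qed.

(** * Queue length and memory, also inside an iteration *)

Definition config_ok (H : seq E) (n : nat) (c : config Q) : bool :=
  let l := pq_length (cfg_queue c) in
  [&& l * l.-1 <= 2 * n, size (cfg_list c) <= l.+1,
      all (mem H) (cfg_list c) & all (mem H) (pq_elems (cfg_queue c))].

Lemma config_ok_mono H H' n n' c : {subset H <= H'} -> n <= n' ->
  config_ok H n c -> config_ok H' n' c.
Proof.
move=> HH' nn' /and4P[lo lb Hl Hq]; apply/and4P; split=> //.
- by apply: leq_trans lo _; rewrite leq_mul2l.
- by apply: sub_all Hl => p /HH'.
- by apply: sub_all Hq => p /HH'.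
Qed.

(** The extracted pair stays in the list until the end of the iteration, so the list may be longer
    than the queue by one. *)
Lemma history_ok n : all (config_ok (handled n) n) (st_history (run n)).
Proof.
elim: n => [|n IH].
  have qp : perm_eq (pq_elems (pq_insert (amin, bmin) (pq_empty Q)))
      [:: (amin, bmin)].
    by rewrite (permPl (pq_insertP _ _)) pq_emptyP.
  rewrite /= andbT /config_ok /pq_length (perm_size qp) (perm_all _ qp) /=.
  by rewrite mem_head.
rewrite runS; have hs := @handledS n.
have invS := invariant_run n.+1; have sz := invariant_size invS.
have so := size_out n.+1.
case qe: (pq_extract (cfg_queue (st_cfg (run n)))) => [[e q]|]; last first.
  rewrite step_halt //; apply: sub_all IH => c.
  exact: (config_ok_mono hs (leqnSn n)).
have [M1 [M2 [Me qM _]]] := extract_split (invariant_run n) qe.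
have := inv_stair (invariant_run n).
rewrite Me => /stair_cat_notin /andP[eM1 _].
move: hs sz so; rewrite /Defs.handled !runS (stepE sA sB qe Me eM1).
set r := seq_of_opt (right_candidate _ _ _).
set u := seq_of_opt (up_candidate _ _ _) => /=.
set H := _ ++ M1 ++ _ => hs sz so.
rewrite all_cat; apply/andP; split.
  by apply: sub_all IH => c; exact: (config_ok_mono hs (leqnSn n)).
have rP := insert_optP (right_candidate sA (M1 ++ e :: M2) e) q.
have uP := insert_optP (up_candidate sB (M1 ++ e :: r ++ M2) e)
  (insert_opt (right_candidate sA (M1 ++ e :: M2) e) q).
have eH : e \in H by rewrite /H mem_cat mem_rcons mem_head.
have [M1H uH rH M2H] : [/\ all (mem H) M1, all (mem H) u,
    all (mem H) r & all (mem H) M2].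
  by split; apply/allP => p pM; change (p \in H); rewrite !mem_cat pM ?orbT.
(* After the extraction the queue only grows, up to the length of the final list; [invariant_size]
   for that list thus bounds all four configurations. *)
have ub (l : nat) : l <= size (M1 ++ u ++ r ++ M2) -> l * l.-1 <= 2 * n.+1.
  move=> lm; apply: leq_trans (leq_trans sz (leq_mul (leqnn 2) so)).
  by apply: leq_mul => //; case: l (size _) lm => [|l] [].
rewrite /= /config_ok /pq_length /= !(perm_all _ uP, perm_size uP).
rewrite -/r -/u.
rewrite !(perm_all _ rP, perm_size rP, perm_all _ qM, perm_size qM, size_cat,
  all_cat, M1H, uH, rH, M2H) -/r /=.
rewrite !(perm_all _ rP, perm_size rP, perm_all _ qM, perm_size qM, size_cat,
  all_cat, M1H, uH, rH, M2H, eH) /= !andbT.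
rewrite !size_cat in ub.
move: (size M1) (size M2) (size u) (size r) ub => a b c d; clear => ub.
do !(apply/andP; split => //); try (by apply: ub; lia); lia.
Qed.

Lemma peak_queue_bound n :
  let m := peak_queue_length sA sB amin bmin Q n in m * m.-1 <= 2 * n.
Proof.
apply: (all_bigmax (P := fun m => m * m.-1 <= 2 * n)) => //.
by apply: sub_all (history_ok n) => c /and4P[].
Qed.

Lemma peak_memory_bound (cm : cost_model E) n S W :
  (forall m, m * m.-1 <= 2 * n -> m <= S) ->
  (forall e, e \in handled n -> elem_memory cm e <= W) ->
  peak_memory sA sB amin bmin Q cm n
    <= S.+1 * (W + 2 * pointer_bits S.+1) + S * (W + pointer_bits S.+1).
Proof.
move=> qb hW; apply: (all_bigmax (P := leq^~ _)) => //.
apply: sub_all (history_ok n) => c /and4P[/qb lS ll cl cq].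
have lS1 : size (cfg_list c) <= S.+1 by apply: leq_trans ll _.
have wS : pointer_bits (size (cfg_list c)) <= pointer_bits S.+1.
  exact: leq_up_log.
apply: leq_add.
  apply: leq_trans (leq_mul lS1 (leqnn _)); apply: all_leq_sum.
  apply: sub_all cl => p /hW pW.
  by rewrite leq_add // leq_mul2l wS orbT.
apply: leq_trans (leq_mul lS (leqnn _)); apply: all_leq_sum.
by apply: sub_all cq => p /hW pW; rewrite leq_add.
Qed.

(** * Arguments and number of the operations *)

Definition op_in (H : seq E) (o : op E) : bool := all (mem H) (op_args o).

Lemma elem_steps_in (H L : seq E) (t : seq (elem_op E)) :
  {subset flatten (map elem_op_args t) <= L} -> {subset L <= H} ->
  all (op_in H) (map (@OnElem E) t).
Proof.
move=> tL LH; rewrite all_map; elim: t tL => //= o t IH tL.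
apply/andP; split.
  by apply/allP => p po; apply/LH/tL; rewrite mem_cat po.
by apply: IH => p pt; apply: tL; rewrite mem_cat pt orbT.
Qed.

Lemma add_opt_ops_in (H : seq E) (c : config Q) e (x : option E) :
  {subset pq_elems (cfg_queue c) <= H} -> {subset seq_of_opt x <= H} ->
  all (op_in H) (add_opt_ops c e x).
Proof.
case: x => [x|] //= cH xH; have {}xH : x \in H by apply: xH; rewrite inE.
rewrite /op_in /= xH /=.
apply: (elem_steps_in (@pq_insert_stepsP _ _ _ _ _ _ _)).
by move=> p; rewrite inE => /predU1P[->|/cH].
Qed.

Lemma compare_ops_in (H : seq E) e (nb : option E) :
  e \in H -> {subset seq_of_opt nb <= H} -> all (op_in H) (compare_ops e nb).
Proof.
by case: nb => [x|] /= eH xH; rewrite /op_in /= eH //= xH ?inE.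
Qed.

Lemma mem_ohead (T : eqType) (s : seq T) : {subset seq_of_opt (ohead s) <= s}.
Proof. by case: s => //= x s y; rewrite !inE => ->. Qed.

(** Needed because [behaves_polynomially] bounds costs on handled pairs only. The neighbours and the
    queue entries come from the old list, and the candidates are in the new one. *)
Lemma trace_in n : all (op_in (handled n)) (st_trace (run n)).
Proof.
elim: n => [|n IH].
  rewrite /op_in /= mem_head /=.
  apply: (elem_steps_in (@pq_insert_stepsP _ _ _ _ _ _ _)).
  by rewrite pq_emptyP.
rewrite runS; have hs := @handledS n.
case qe: (pq_extract (cfg_queue (st_cfg (run n)))) => [[e q]|]; last first.
  by rewrite step_halt //; apply: sub_all IH => o; apply: sub_all => p /hs.
have [M1 [M2 [Me qM _]]] := extract_split (invariant_run n) qe.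
have := inv_stair (invariant_run n).
rewrite Me => /stair_cat_notin /andP[eM1 _].
have qsM := perm_mem (inv_queue (invariant_run n)).
have Mh : {subset M1 ++ e :: M2 <= handled n.+1}.
  by move=> p pM; apply: hs; rewrite mem_cat Me pM orbT.
move: hs Mh; rewrite /Defs.handled !runS (stepE sA sB qe Me eM1).
set r := right_candidate _ _ _.
set u := up_candidate _ _ _ => /=.
set H := _ ++ M1 ++ _ => hs Mh.
rewrite all_cat; apply/andP; split.
  by apply: sub_all IH => o; apply: sub_all => p /hs.
have eH : e \in H by apply: Mh; rewrite mem_cat mem_head orbT.
have M1H : {subset M1 <= H} by move=> p pM; apply: Mh; rewrite mem_cat pM.
have M2H : {subset M2 <= H}.
  by move=> p pM; apply: Mh; rewrite mem_cat inE pM !orbT.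
have qH : {subset pq_elems q <= H}.
  by move=> p; rewrite (perm_mem qM) mem_cat => /orP[/M1H|/M2H].
have rH : {subset seq_of_opt r <= H}.
  by move=> p pr; rewrite /H !mem_cat pr !orbT.
have uH : {subset seq_of_opt u <= H}.
  by move=> p pu; rewrite /H !mem_cat pu !orbT.
have qrH : {subset pq_elems (insert_opt r q) <= H}.
  by move=> p; rewrite (perm_mem (insert_optP _ _)) mem_cat => /orP[/rH|/qH].
rewrite /iteration_trace !all_cat !add_opt_ops_in // !compare_ops_in //.
- rewrite (elem_steps_in (@pq_extract_stepsP _ _ _ _ _ _)) /op_in /= ?eH //.
  by move=> p; rewrite qsM Me => /Mh.
- by move=> p /mem_ohead; rewrite mem_rev => /M1H.
- by move=> p /mem_ohead /M2H.
Qed.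

(** An iteration makes one extraction and at most two insertions, hence 3 K, and at most 14 further
    operations; the initialization accounts for the extra factor in [n.+1]. The bound [N] stays
    fixed during the induction, so that [K] does too. *)
Lemma trace_size n N K : n <= N ->
  (forall q : pq_state Q, pq_length q * (pq_length q).-1 <= 2 * N ->
     size (pq_extract_steps q) <= K /\
     forall e, size (pq_insert_steps e q) <= K) ->
  size (st_trace (run n)) <= n.+1 * (3 * K + 14).
Proof.
move=> nN hK; elim: n nN => [_|n IH nN].
  rewrite /= size_map; have [|_ /(_ (amin, bmin)) h] := hK (pq_empty Q).
    by rewrite /pq_length pq_emptyP.
  by apply: (@leq_trans K.+3) => [|]; [exact: h | lia].
have {}IH := IH (ltnW nN).
case qe: (pq_extract (cfg_queue (st_cfg (run n)))) => [[e q]|]; last first.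
  by rewrite runS step_halt //; lia.
have [M1 [M2 [Me qM _]]] := extract_split (invariant_run n) qe.
have := inv_stair (invariant_run n).
rewrite Me => /stair_cat_notin /andP[eM1 _].
have sz : pq_length (cfg_queue (st_cfg (run n))) *
    (pq_length (cfg_queue (st_cfg (run n)))).-1 <= 2 * N.
  rewrite /pq_length (perm_size (inv_queue (invariant_run n))).
  apply: leq_trans (invariant_size (invariant_run n)) _; rewrite leq_mul2l /=.
  exact: leq_trans (size_out n) (ltnW nN).
have [hext _] := hK _ sz.
(* The insertions act on the queues of the first two intermediate configurations, whose lengths are
   recorded in the history. *)
have := history_ok n.+1; rewrite runS (stepE sA sB qe Me eM1).
set r := right_candidate _ _ _.
set u := up_candidate _ _ _ => /=.
rewrite all_cat => /andP[_] /=.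
case/and3P => /and4P[/= q0 _ _ _] /and4P[/= q1 _ _ _] _.
have leN : 2 * n.+1 <= 2 * N by rewrite leq_mul2l.
have [_ h0] := hK _ (leq_trans q0 leN).
have [_ h1] := hK _ (leq_trans q1 leN).
have cmp (e' : E) (nb : option E) : size (compare_ops e' nb) <= 2 by case: nb.
have add (c : config Q) (x : option E) :
    (forall e', size (pq_insert_steps e' (cfg_queue c)) <= K) ->
    size (add_opt_ops c e x) <= 3 + K.
  by case: x => [x|] //= h; rewrite size_map !ltnS.
rewrite size_cat /iteration_trace !size_cat size_map.
have := add (Config (M1 ++ e :: M2) q) r h0.
have := add (Config (M1 ++ e :: seq_of_opt r ++ M2) (insert_opt r q)) u h1.
have := cmp e (ohead M2); have := cmp e (ohead (rev M1)).
move: hext IH; set x1 := size (pq_extract_steps _).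
set x2 := size (compare_ops _ _).
set x3 := size (compare_ops _ _); set x4 := size (add_opt_ops _ _ _).
set x5 := size (add_opt_ops _ _ _); set x6 := size (st_trace _).
rewrite /=; lia.
Qed.

Lemma total_time_bound (cm : cost_model E) n K T :
  (forall q : pq_state Q, pq_length q * (pq_length q).-1 <= 2 * n ->
     size (pq_extract_steps q) <= K /\
     forall e, size (pq_insert_steps e q) <= K) ->
  (forall o : elem_op E, {subset elem_op_args o <= handled n} ->
     elem_time cm o <= T) ->
  \max_(o <- st_trace (run n)) list_time_in cm o <= T ->
  total_time sA sB amin bmin Q cm n <= n.+1 * (3 * K + 14) * T.
Proof.
move=> hK hT lT.
apply: leq_trans (leq_mul (trace_size (leqnn n) hK) (leqnn T)).
have := all_leq_bigmax (list_time_in cm) (st_trace (run n)).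
move/(conj (trace_in n))/andP; rewrite -all_predI => h.
apply: all_leq_sum; apply: sub_all h; case=> o /andP[/= oH oT].
  by apply: hT => p; apply/allP.
exact: leq_trans oT lT.
Qed.

(** * Asymptotic time and memory *)

Context {R : realType}.
Variable cm : cost_model (A * B)%type.

Local Notation reaches := (reaches sA sB amin bmin Q).

Lemma pq_steps_truncn (c : R) (n : nat) :
  (forall q : pq_state Q,
    ((size (pq_extract_steps q))%:R <= c * (1 + ln (pq_length q)%:R))%R /\
    (forall e : A * B,
      ((size (pq_insert_steps e q))%:R <= c * (1 + ln (pq_length q)%:R))%R)) ->
  1 < n -> (1 <= ln (n%:R : R))%R ->
  let K := Num.truncn (2 * `|c| * ln (n%:R : R))%R in
  forall q : pq_state Q, pq_length q * (pq_length q).-1 <= 2 * n ->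
    size (pq_extract_steps q) <= K /\ forall e, size (pq_insert_steps e q) <= K.
Proof.
move=> hc n1 L1 K q qn; have [hext hins] := hc q.
(* This crude bound suffices inside a logarithm. It needs n > 1: for n = 1 a length of 2 is
   allowed. *)
have qln : pq_length q <= n by case: (pq_length q) qn => // l /=; nia.
have bound : (c * (1 + ln (pq_length q)%:R) <= 2 * `|c| * ln n%:R)%R.
  have := ler_ln_nat (R := R) qln; have := ln_nat_ge0 (R := R) (pq_length q).
  have := ler_norm c; have := normr_ge0 c => c0 cc l0 lL.
  apply: (@le_trans _ _ (`|c| * (1 + ln (pq_length q)%:R))%R).
    by rewrite ler_wpM2r // addr_ge0.
  by rewrite mulrAC [leRHS]mulrC ler_wpM2l //; lra.
by split=> [|e]; apply: leq_truncn; apply: le_trans bound.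
Qed.

Lemma time_bigO :
  pq_logarithmic R Q -> logarithmic_list_ops sA sB amin bmin Q cm R ->
  behaves_polynomially sA sB amin bmin Q cm R ->
  bigO_on reaches
    (fun n => (total_time sA sB amin bmin Q cm n)%:R : R)%R
    (fun n => n%:R * ln n%:R ^+ 2 : R)%R.
Proof.
move=> [c hc] [Cl [Nl hl]].
move=> [_ [[[C1 [N1 h1]] _] _] [[[C2 [N2 h2]] _] _] [[[C3 [N3 h3]] _] _]].
pose C := (`|Cl| + `|C1| + `|C2| + `|C3|)%R.
(* The factors come from n + 1 <= 2 n, from 3 K + 14 with K <= 2 |c| ln n, and from the cost C ln n
   of a single operation. *)
exists (2 * (6 * `|c| + 14) * C)%R.
exists (Num.truncn (expR 1 : R) + Nl + N1 + N2 + N3 + 2) => n Nn rn.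
have [en n1 Nln] : [/\ Num.truncn (expR 1 : R) < n, 1 < n & Nl <= n].
  by move: Nn; clear; split; lia.
have [N1n N2n N3n] : [/\ N1 <= n, N2 <= n & N3 <= n].
  by move: Nn; clear; split; lia.
have L1 : (1 <= ln (n%:R : R))%R by apply: ln_nat_ge1.
set L := ln (n%:R : R) in L1 *; have L0 : (0 <= L)%R by lra.
have C0 : (0 <= C)%R by rewrite /C !addr_ge0.
have le_T (D : R) : (`|D| <= C)%R ->
    Num.truncn (`|D| * `|L|)%R <= Num.truncn (C * L)%R.
  move=> DC; apply: leq_truncn.
  apply: (@le_trans _ _ (`|D| * `|L|)%R); first by rewrite truncn_le mulr_ge0.
  by rewrite [`|L|%R]ger0_norm // ler_wpM2r.
have [lC C1C C2C C3C] : [/\ (`|Cl| <= C)%R, (`|C1| <= C)%R, (`|C2| <= C)%R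
    & (`|C3| <= C)%R].
  have := (normr_ge0 Cl, normr_ge0 C1, normr_ge0 C2, normr_ge0 C3).
  by rewrite /C => -[[[? ?] ?] ?]; split; lra.
have bound := @total_time_bound cm n _ (Num.truncn (C * L)%R)
  (pq_steps_truncn hc n1 L1).
rewrite ger0_norm // (ger0_norm (mulr_ge0 _ (sqr_ge0 _))) //.
set K := Num.truncn (2 * `|c| * L)%R in bound.
have KL : (K%:R <= 2 * `|c| * L)%R.
  by rewrite truncn_le mulr_ge0 // mulr_ge0.
have TL : ((Num.truncn (C * L))%:R <= C * L)%R by rewrite truncn_le mulr_ge0.
apply: (@le_trans _ _ (n.+1 * (3 * K + 14) * Num.truncn (C * L)%R)%:R%R).
  rewrite ler_nat; apply: bound.
    case=> [e|e|e e'] /= oh.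
    - apply: leq_trans (le_T _ C1C); apply: worst_leq (h1 n N1n rn) _.
      by apply: map_f; apply: oh; rewrite inE.
    - apply: leq_trans (le_T _ C2C); apply: worst_leq (h2 n N2n rn) _.
      by apply: map_f; apply: oh; rewrite inE.
    - apply: leq_trans (le_T _ C3C); apply: worst_leq (h3 n N3n rn) _.
      by apply/allpairs_f; apply: oh; rewrite !inE eqxx ?orbT.
  apply: leq_trans (le_T _ lC); apply: leq_truncn.
  have := hl n Nln rn; rewrite ger0_norm // => /le_trans; apply.
  by rewrite ler_wpM2r // ler_norm.
have nS : (n.+1%:R <= 2 * n%:R :> R)%R.
  by rewrite -natrM ler_nat mul2n -addnn -addn1 leq_add2l ltnW.
have KS : ((3 * K + 14)%:R <= (6 * `|c| + 14) * L :> R)%R.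
  by rewrite natrD natrM; nra.
rewrite natrM (natrM _ n.+1).
apply: (@le_trans _ _ ((2 * n%:R) * ((6 * `|c| + 14) * L) * (C * L))%R).
  by rewrite ler_pM ?mulr_ge0 ?ler0n // ler_pM.
by rewrite le_eqVlt; apply/orP; left; apply/eqP; ring.
Qed.

Lemma memory_bigO :
  behaves_polynomially sA sB amin bmin Q cm R ->
  bigO_on reaches
    (fun n => (peak_memory sA sB amin bmin Q cm n)%:R : R)%R
    (fun n => Num.sqrt n%:R * ln n%:R : R)%R.
Proof.
move=> [[[[C [N hC]] _] _] _ _ _].
(* A pointer takes at most 1 + ln (n^2) / ln 2 bits, which is at most P ln n once ln n >= 1. *)
pose P := (1 + 2 / ln 2 : R)%R.
have ln2 : (0 < ln 2 :> R)%R by rewrite ln_gt0 // ltr1n.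
have P0 : (0 <= P)%R by rewrite addr_ge0 // divr_ge0 // ltW.
(* This is 4 (|C| + 2 P) + 3 (|C| + P): at most 4 sqrt n list nodes with two pointers each, and 3
   sqrt n queue entries with one. *)
exists (7 * `|C| + 11 * P)%R.
exists (Num.truncn (expR 1 : R) + N + 5) => n Nn rn.
have [en Nn' n5] : [/\ Num.truncn (expR 1 : R) < n, N <= n & 5 <= n].
  by move: Nn; clear; split; lia.
have L1 : (1 <= ln (n%:R : R))%R by apply: ln_nat_ge1.
set L := ln (n%:R : R) in L1 *; have L0 : (0 <= L)%R by lra.
set s := Num.sqrt (n%:R : R).
have s0 : (0 <= s)%R by exact: sqrtr_ge0.
have s2 : (s ^+ 2 = n%:R)%R by rewrite sqr_sqrtr.
have s1 : (1 <= s)%R.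
  by rewrite -sqrtr1 ler_sqrt // ler1n; lia.
pose S := Num.truncn (Num.sqrt (2 * n%:R) + 1 : R)%R.
have S3 : (S%:R <= 3 * s)%R.
  apply: (@le_trans _ _ (Num.sqrt (2 * n%:R) + 1 : R)%R).
    by rewrite truncn_le addr_ge0 ?sqrtr_ge0.
  have : (Num.sqrt (2 * n%:R) <= 2 * s :> R)%R.
    rewrite -(ger0_norm (mulr_ge0 (ler0n R 2) s0)) -sqrtr_sqr.
    rewrite ler_sqrt ?sqr_ge0 //.
    by rewrite exprMn s2; have := ler0n R n; nra.
  lra.
(* [pointer_bits S.+1] is [up_log 2 S.+2]; the bound follows from 3 n + 2 <= n^2, valid as n >=
   5. *)
have Sn : S.+2 <= n * n.
  have : (S%:R <= 3 * n%:R :> R)%R by rewrite -s2; nra.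
  by rewrite -natrM ler_nat; nia.
have wP : ((pointer_bits S.+1)%:R <= P * L)%R.
  apply: (@le_trans _ _ (up_log 2 (n * n))%:R%R).
    by rewrite ler_nat; exact: leq_up_log.
  apply: le_trans (up_log_le_ln _) _; first by nia.
  rewrite mulnn natrX lnXn ?ltr0n; last by lia.
  by rewrite -/L -[(L *+ 2)%R]mulr_natl mulrAC [leRHS]mulrDl mul1r lerD2r.
have bound := @peak_memory_bound cm n S (Num.truncn (`|C| * `|L|)%R).
rewrite ger0_norm // (ger0_norm (mulr_ge0 _ _)) //.
have WL : ((Num.truncn (`|C| * `|L|))%:R <= `|C| * L)%R.
  by rewrite -{2}(ger0_norm L0) truncn_le mulr_ge0.
set W := Num.truncn _ in bound WL.
set w := pointer_bits _ in bound wP.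
apply: (@le_trans _ _ (S.+1 * (W + 2 * w) + S * (W + w))%:R%R).
  rewrite ler_nat; apply: bound.
    by move=> m /(@triangular_sqrt R) /leq_truncn.
  move=> e eh; apply: worst_leq (hC n Nn' rn) _; exact: map_f.
rewrite natrD (natrM _ S.+1) (natrM _ S) (natrD _ W (2 * w)) (natrD _ W w).
rewrite (natrM _ 2).
apply: (@le_trans _ _ (4 * s * (`|C| * L + 2 * (P * L))
                       + 3 * s * (`|C| * L + P * L))%R).
  apply: lerD; apply: ler_pM; rewrite ?addr_ge0 ?mulr_ge0 //.
  - by rewrite -natr1; lra.
  - by rewrite lerD // ler_wpM2l.
  - by rewrite lerD.
by rewrite le_eqVlt; apply/orP; left; apply/eqP; ring.
Qed.

End Run.

Theorem theorem16 (R : realType) (dA dB dZ : Order.disp_t)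
    (A : orderType dA) (B : orderType dB) (Z : orderType dZ)
    (f : A * B -> Z)
    (sA : A -> option A) (sB : B -> option B) (amin : A) (bmin : B)
    (Q : pqueue f)
    (f_bimonotone : bimonotone f) (f_proper : proper_map f)
    (sA_succ : successor_fun sA) (sB_succ : successor_fun sB)
    (amin_least : least amin) (bmin_least : least bmin) :
  [/\ (forall p : A * B,
         exists! k : nat, output sA sB amin bmin Q k = Some p),
      (forall (i j : nat) (p q : A * B), (i <= j)%N ->
         output sA sB amin bmin Q i = Some p ->
         output sA sB amin bmin Q j = Some q ->
         (f p <= f q)%O),
      (forall n : nat,
         ((peak_queue_length sA sB amin bmin Q n)%:R
            <= Num.sqrt (2 * n%:R) + 1 :> R)%R) &
      (forall cm : cost_model (A * B)%type,
         pq_logarithmic R Q ->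
         logarithmic_list_ops sA sB amin bmin Q cm R ->
         behaves_polynomially sA sB amin bmin Q cm R ->
         bigO_on (reaches sA sB amin bmin Q)
           (fun n => (total_time sA sB amin bmin Q cm n)%:R : R)%R
           (fun n => n%:R * ln n%:R ^+ 2 : R)%R /\
         bigO_on (reaches sA sB amin bmin Q)
           (fun n => (peak_memory sA sB amin bmin Q cm n)%:R : R)%R
           (fun n => Num.sqrt n%:R * ln n%:R : R)%R)].
Proof.
split.
- exact: output_exists_unique.
- by move=> i j p q; exact: output_monotone.
- by move=> n; apply: triangular_sqrt; exact: peak_queue_bound.
- by move=> cm hQ hl hp; split; [exact: time_bigO | exact: memory_bigO].
Qed.
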